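(* Let $\mathcal{C}\subset\mathbb{R}^d$ be closed and nonempty, let $\|\cdot\|$ be any norm on $\mathbb{R}^d$ with dual norm $\|\cdot\|^*$, and fix $\gamma\in[0,\infty]$. Consider the following five properties of a pair $x,y\in\mathcal{C}$: (Curvature) $\displaystyle \limsup_{t\searrow 0}\frac{\min_{z\in\mathcal{C}}\|z-((1-t)x+ty)\|}{t}\le \gamma\|x-y\|_2^2$. (Two-sided contraction) For any $z,w\in\mathbb{R}^d$ with $P_{\mathcal{C}}(z)=x$ and $P_{\mathcal{C}}(w)=y$, $\ (1-\gamma\|z-x\|^*-\gamma\|w-y\|^* )\cdot\|x-y\|_2\le\|z-w\|_2$. (One-sided contraction) For any $z\in\mathbb{R}^d$ with $P_{\mathcal{C}}(z)=x$, $\ (1-\gamma\|z-x\|^* )\cdot\|x-y\|_2\le\|z-y\|_2$. (First-order optimality) For any differentiable $f:\mathbb{R}^d\to\mathbb{R}$ such that $x$ is a local minimizer of $f$ over $\mathcal{C}$, $\ \langle y-x,\nabla f(x)\rangle\ge-\gamma\|\nabla f(x)\|^*\|y-x\|_2^2$. (Inner products) For any $z\in\mathbb{R}^d$ with $P_{\mathcal{C}}(z)=x$, $\ \langle y-x,z-x\rangle\le\gamma\|z-x\|^*\|y-x\|_2^2$. Then these five properties are equivalent in the following sense: for the fixed $\gamma$, either all five hold for every $x,y\in\mathcal{C}$, or each of the five fails for some $x,y\in\mathcal{C}$.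
   Context: $\|\cdot\|_2$ is the Euclidean norm and $\langle\cdot,\cdot\rangle$ the standard inner product. $P_{\mathcal{C}}$ denotes projection in the $\ell_2$ norm: $P_{\mathcal{C}}(z)\in\arg\min_{x\in\mathcal{C}}\|x-z\|_2$; if the minimizer is non-unique, $P_{\mathcal{C}}(z)$ denotes any minimizer, any claim or assumption involving $P_{\mathcal{C}}(z)$ is to hold for every choice, and ''$P_{\mathcal{C}}(z)=x$'' means that $x$ is a minimizer. The convention $0\cdot\infty=0$ is used, so that all properties hold trivially for $\gamma=\infty$. *)

(* Defs.v *)
From HB Require Import structures.
From mathcomp Require Import all_boot all_order all_algebra.
From mathcomp Require Import all_classical all_reals all_analysis.

Set Implicit Arguments.
Unset Strict Implicit.
Unset Printing Implicit Defensive.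

Import Order.TTheory GRing.Theory Num.Theory.
Import numFieldNormedType.Exports.

Local Open Scope classical_set_scope.
Local Open Scope ring_scope.

(* R^d is 'rV[R]_d.  The library's norm `|_| on it is the sup norm; it is used
   only through the (usual) topology it induces: closed sets, neighborhoods and
   differentiability. *)

Definition dot (R : realType) (d : nat) (u v : 'rV[R]_d) : R :=
  \sum_(i < d) u 0 i * v 0 i.

Definition norm2 (R : realType) (d : nat) (u : 'rV[R]_d) : R :=
  Num.sqrt (dot u u).

(* Nonnegativity and N 0 = 0 follow from these axioms. *)
Record is_norm (R : realType) (d : nat) (N : 'rV[R]_d -> R) : Prop := IsNorm {
  is_norm_triangle : forall u v, N (u + v) <= N u + N v ;
  is_norm_scale : forall (a : R) u, N (a *: u) = `|a| * N u ;
  is_norm_definite : forall u, N u = 0 -> u = 0 }.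

(* The set is nonempty and bounded when N is a norm, so sup is not the default
   value here. *)
Definition dual_norm (R : realType) (d : nat) (N : 'rV[R]_d -> R)
    (u : 'rV[R]_d) : R :=
  sup [set dot u v | v in [set v | N v <= 1]].

(* x is one of the Euclidean projections of z on C, so that quantifying over
   all z with [is_proj C z x] covers every choice of the minimizer. *)
Definition is_proj (R : realType) (d : nat) (C : set 'rV[R]_d)
    (z x : 'rV[R]_d) : Prop :=
  C x /\ forall u, C u -> norm2 (x - z) <= norm2 (u - z).

(* For C closed and nonempty and N a norm this infimum is attained, i.e. it is
   the minimum of N (z - p) over z in C. *)
Definition dist (R : realType) (d : nat) (N : 'rV[R]_d -> R)
    (C : set 'rV[R]_d) (p : 'rV[R]_d) : R :=
  inf [set N (z - p) | z in C].

Definition local_minimizer (R : realType) (d : nat) (C : set 'rV[R]_d)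
    (f : 'rV[R]_d -> R) (x : 'rV[R]_d) : Prop :=
  C x /\ \forall z \near x, C z -> f x <= f z.

(* Row of partial derivatives. *)
Definition grad (R : realType) (d : nat) (f : 'rV[R]_d -> R) (x : 'rV[R]_d) :
    'rV[R]_d :=
  \row_(j < d) 'D_(delta_mx 0 j) f x.

(* The parameter g ranges over extended reals; the library's product satisfies
   0 * +oo = 0. *)
Local Open Scope ereal_scope.

Definition curvature (R : realType) (d : nat) (C : set 'rV[R]_d)
    (N : 'rV[R]_d -> R) (g : \bar R) (x y : 'rV[R]_d) : Prop :=
  limf_esup
    (fun t : R => (dist N C ((1 - t) *: x + t *: y) / t)%:E) (0%R : R)^'+
  <= g * (norm2 (x - y) ^+ 2)%:E.

Definition two_sided_contraction (R : realType) (d : nat) (C : set 'rV[R]_d)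
    (N : 'rV[R]_d -> R) (g : \bar R) (x y : 'rV[R]_d) : Prop :=
  forall z w : 'rV[R]_d, is_proj C z x -> is_proj C w y ->
    (1 - g * (dual_norm N (z - x))%:E - g * (dual_norm N (w - y))%:E)
      * (norm2 (x - y))%:E
    <= (norm2 (z - w))%:E.

Definition one_sided_contraction (R : realType) (d : nat) (C : set 'rV[R]_d)
    (N : 'rV[R]_d -> R) (g : \bar R) (x y : 'rV[R]_d) : Prop :=
  forall z : 'rV[R]_d, is_proj C z x ->
    (1 - g * (dual_norm N (z - x))%:E) * (norm2 (x - y))%:E
    <= (norm2 (z - y))%:E.

Definition first_order_optimality (R : realType) (d : nat) (C : set 'rV[R]_d)
    (N : 'rV[R]_d -> R) (g : \bar R) (x y : 'rV[R]_d) : Prop :=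
  forall f : 'rV[R]_d -> R, (forall p : 'rV[R]_d, differentiable f p) ->
    local_minimizer C f x ->
    (dot (y - x) (grad f x))%:E
    >= - (g * (dual_norm N (grad f x))%:E * (norm2 (y - x) ^+ 2)%:E).

Definition inner_products (R : realType) (d : nat) (C : set 'rV[R]_d)
    (N : 'rV[R]_d -> R) (g : \bar R) (x y : 'rV[R]_d) : Prop :=
  forall z : 'rV[R]_d, is_proj C z x ->
    (dot (y - x) (z - x))%:E
    <= g * (dual_norm N (z - x))%:E * (norm2 (y - x) ^+ 2)%:E.

(* Main.v *)
(* For finite gamma the implications are
     curvature => first-order => inner products   (for each pair x, y),
     two-sided => one-sided => inner products     (for each pair x, y),
     inner products for (x, y) and (y, x) => two-sided,
   together with the one step which really uses all pairs of points of C: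
   inner products => curvature.  For the latter put q = (1 - t) x + t y,
   e = t^2, and minimize N (p - q) + |z - p|_2^2 / (2 e) over z in C and p in
   R^d.  At a minimizer z is a projection of p, and convexity of N makes
   u = (z - p) / e a subgradient of N at p - q, i.e. u has dual norm at most 1
   and <u, p - q> = N (p - q).  As p - z = - e u, the inner product property at
   the pairs (z, x) and (z, y), averaged with weights 1 - t and t, gives
   N (p - q) <= gamma (|z - q|_2^2 + t (1 - t) |x - y|_2^2), where
   |z - q|_2 = O(t) and N (z - p) = O(t^2). *)
Require Import Defs.
From mathcomp Require Import all_boot all_order all_algebra.
From mathcomp Require Import all_classical all_reals all_analysis.
From mathcomp Require Import ring lra.

Import Order.TTheory GRing.Theory Num.Theory.
Import numFieldNormedType.Exports.

Local Open Scope classical_set_scope.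
Local Open Scope ring_scope.

(** * Euclidean inner product and norm *)

Section Euclidean.
Context {R : realType} {d : nat}.
Implicit Types (a : R) (u v w : 'rV[R]_d).

Lemma dotC u v : dot u v = dot v u.
Proof. by apply: eq_bigr => i _; rewrite mulrC. Qed.

Lemma dotDl u v w : dot (u + v) w = dot u w + dot v w.
Proof. by rewrite /dot -big_split; apply: eq_bigr => i _; rewrite mxE mulrDl. Qed.

Lemma dotZl a u v : dot (a *: u) v = a * dot u v.
Proof. by rewrite /dot mulr_sumr; apply: eq_bigr => i _; rewrite mxE mulrA. Qed.

Lemma dotNl u v : dot (- u) v = - dot u v.
Proof. by rewrite -scaleN1r dotZl mulN1r. Qed.

Lemma dotBl u v w : dot (u - v) w = dot u w - dot v w.
Proof. by rewrite dotDl dotNl. Qed.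

Lemma dotDr u v w : dot u (v + w) = dot u v + dot u w.
Proof. by rewrite dotC dotDl !(dotC _ u). Qed.

Lemma dotZr a u v : dot u (a *: v) = a * dot u v.
Proof. by rewrite dotC dotZl dotC. Qed.

Lemma dotNr u v : dot u (- v) = - dot u v.
Proof. by rewrite dotC dotNl dotC. Qed.

Lemma dotBr u v w : dot u (v - w) = dot u v - dot u w.
Proof. by rewrite dotDr dotNr. Qed.

Definition dotE := (dotBl, dotBr, dotDl, dotDr, dotNl, dotNr, dotZl, dotZr).

Lemma dot0r u : dot u 0 = 0.
Proof. by rewrite -(scale0r u) dotZr mul0r. Qed.

Lemma dot_ge0 u : 0 <= dot u u.
Proof. by apply: sumr_ge0 => i _; rewrite -expr2 sqr_ge0. Qed.

Lemma dot_eq0 u : dot u u = 0 -> u = 0.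
Proof.
move/eqP; rewrite psumr_eq0 => [/allP u0|i _]; last by rewrite -expr2 sqr_ge0.
apply/rowP => i; rewrite mxE; apply/eqP.
by have := u0 i (mem_index_enum i); rewrite mulf_eq0 orbb.
Qed.

Lemma norm2_ge0 u : 0 <= norm2 u.
Proof. exact: sqrtr_ge0. Qed.

Lemma sqr_norm2 u : norm2 u ^+ 2 = dot u u.
Proof. by rewrite sqr_sqrtr ?dot_ge0. Qed.

Lemma norm2_eq0 u : norm2 u = 0 -> u = 0.
Proof. by move=> u0; apply: dot_eq0; rewrite -sqr_norm2 u0 expr0n. Qed.

Lemma norm2_le u v : (norm2 u <= norm2 v) = (dot u u <= dot v v).
Proof. by rewrite ler_sqrt ?dot_ge0. Qed.

Lemma norm2N u : norm2 (- u) = norm2 u.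
Proof. by rewrite /norm2 !dotE opprK. Qed.

Lemma norm2Z a u : norm2 (a *: u) = `|a| * norm2 u.
Proof. by rewrite /norm2 !dotE mulrA -expr2 sqrtrM ?sqr_ge0// sqrtr_sqr. Qed.

Lemma Cauchy_Schwarz u v : dot u v <= norm2 u * norm2 v.
Proof.
have [/norm2_eq0 ->|u0] := eqVneq (norm2 u) 0.
  by rewrite dotC dot0r mulr_ge0 ?norm2_ge0.
have [/norm2_eq0 ->|v0] := eqVneq (norm2 v) 0.
  by rewrite dot0r mulr_ge0 ?norm2_ge0.
have ab : 0 < norm2 u * norm2 v by rewrite mulr_gt0 // lt0r ?u0 ?v0 norm2_ge0.
(* The squared length of |v| u - |u| v is 2 |u| |v| (|u| |v| - <u, v>). *)
rewrite -(ler_pM2l ab); have := dot_ge0 (norm2 v *: u - norm2 u *: v).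
by rewrite !dotE (dotC v u) -!sqr_norm2; lra.
Qed.

Lemma is_norm_norm2 : is_norm (@norm2 R d).
Proof.
split; [move=> u v|exact: norm2Z|exact: norm2_eq0].
rewrite -(@ler_pXn2r _ 2) ?nnegrE ?addr_ge0 ?norm2_ge0//.
rewrite sqr_norm2 !dotE (dotC v u) sqrrD !sqr_norm2.
by have := Cauchy_Schwarz u v; lra.
Qed.

End Euclidean.

(** * Equivalence of norms on R^d *)

Section Norms.
Context {R : realType} {d : nat}.
Variables (N : 'rV[R]_d -> R) (N_norm : is_norm N).
Implicit Types (a : R) (u v w : 'rV[R]_d).

Lemma is_norm_0 : N 0 = 0.
Proof. by rewrite -(scale0r 0) is_norm_scale// normr0 mul0r. Qed.

Lemma is_norm_N u : N (- u) = N u.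
Proof. by rewrite -scaleN1r is_norm_scale// normrN1 mul1r. Qed.

Lemma is_norm_ge0 u : 0 <= N u.
Proof.
by have := is_norm_triangle N_norm u (- u); rewrite subrr is_norm_0 is_norm_N; lra.
Qed.

Lemma is_norm_gt0 u : u != 0 -> 0 < N u.
Proof.
move=> u0; rewrite lt0r is_norm_ge0 andbT.
by apply: contra u0 => /eqP /(is_norm_definite N_norm) ->.
Qed.

Lemma coord_le_norm u i : `|u 0 i| <= `|u|.
Proof.
rewrite [leRHS]/Num.norm/= mx_normrE.
exact: (le_bigmax _ (fun ij : 'I_1 * 'I_d => `|u ij.1 ij.2|) (0, i)).
Qed.

Lemma is_norm_le_sup : exists2 K, 0 < K & forall u, N u <= K * `|u|.
Proof.
pose K := \sum_(i < d) N (delta_mx 0 i).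
have K0 : 0 <= K by apply: sumr_ge0 => i _; exact: is_norm_ge0.
(* The added 1 keeps the constant positive even for d = 0, where the sum is empty. *)
exists (K + 1) => [|u]; first by rewrite ltr_wpDl.
apply: (@le_trans _ _ (K * `|u|)); last by rewrite ler_wpM2r// lerDl.
rewrite mulr_suml {1}(row_sum_delta u).
elim/big_ind2 : _ => [|x a y b xa yb|i _]; first by rewrite is_norm_0.
  exact: le_trans (is_norm_triangle N_norm _ _) (lerD xa yb).
by rewrite is_norm_scale// mulrC ler_wpM2l ?is_norm_ge0 ?coord_le_norm.
Qed.

Lemma is_norm_continuous : continuous N.
Proof.
have [K K0 NK] := is_norm_le_sup.
move=> u; apply/(@cvgrPdist_lt _ _ _ (nbhs u) (nbhs_filter u)) => e e0.
apply/(@nbhs_normP R 'rV[R]_d); exists (e / K) => /= [|v uv].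
  by rewrite divr_gt0.
apply: le_lt_trans (_ : N (u - v) < e); last first.
  by rewrite (le_lt_trans (NK _))// mulrC -ltr_pdivlMr.
have := is_norm_triangle N_norm (u - v) v.
have := is_norm_triangle N_norm (v - u) u.
rewrite !subrK -(is_norm_N (u - v)) opprB => h1 h2.
by rewrite ler_norml; apply/andP; split; lra.
Qed.

(** By compactness [N] attains a minimum on the unit sphere of the sup norm, positive by
    definiteness; its inverse is the constant. *)
Lemma sup_le_is_norm : exists2 K, 0 < K & forall u, `|u| <= K * N u.
Proof.
pose S := [set u : 'rV[R]_d | `|u| = 1].
have normalize u : u != 0 -> S (`|u|^-1 *: u).
  move=> u0; rewrite /S/= normrZ normfV normr_id mulVf//.
  by rewrite normr_eq0.
(* If the sphere is empty (d = 0), every vector is 0. *)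
have [S0|S0] := pselect (S !=set0); last first.
  exists 1 => // u; have [->|u0] := eqVneq u 0; first by rewrite is_norm_0 normr0 mulr0.
  by case: S0; exists (`|u|^-1 *: u); exact: normalize.
have cS : compact S.
  apply: bounded_closed_compact.
    by exists 1; split => // x x1 u /= ->; exact: ltW.
  apply: (@closed_comp _ _ (fun u : 'rV[R]_d => `|u|) [set 1]).
    by move=> u _; exact: norm_continuous.
  exact: closed_eq.
have [|c cS' cmin] := compact_EVT_min S0 cS (f := N).
  by apply: continuous_subspaceT; exact: is_norm_continuous.
have c0 : 0 < N c.
  apply: is_norm_gt0; apply/eqP => c0.
  by move: cS'; rewrite inE /S/= c0 normr0 => /esym/eqP; rewrite oner_eq0.
exists (N c)^-1 => [|u]; first by rewrite invr_gt0.
have [->|u0] := eqVneq u 0; first by rewrite is_norm_0 normr0 mulr0.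
have := cmin _ (mem_set (normalize _ u0)).
rewrite is_norm_scale// normfV normr_id => h.
by rewrite mulrC ler_pdivlMr// mulrC -ler_pdivlMr ?normr_gt0// mulrC.
Qed.

End Norms.

Lemma norm2_gt0 {R : realType} {d : nat} (u : 'rV[R]_d) : u != 0 -> 0 < norm2 u.
Proof. exact: is_norm_gt0 _ is_norm_norm2 _. Qed.

Lemma is_norm_equiv {R : realType} {d : nat} (N N' : 'rV[R]_d -> R) :
  is_norm N -> is_norm N' -> exists2 K, 0 < K & forall u, N u <= K * N' u.
Proof.
move=> /is_norm_le_sup[K K0 NK] /sup_le_is_norm[K' K'0 NK'].
exists (K * K') => [|u]; first exact: mulr_gt0.
by rewrite -mulrA (le_trans (NK u))// ler_pM2l.
Qed.

(** * The dual norm and its duality inequality *)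

Section DualNorm.
Context {R : realType} {d : nat}.
Variables (N : 'rV[R]_d -> R) (N_norm : is_norm N).
Implicit Types (a : R) (u v w : 'rV[R]_d).

Lemma dual_norm_ub u : has_ubound [set dot u v | v in [set v | N v <= 1]].
Proof.
have [K K0 NK] := is_norm_equiv _ _ is_norm_norm2 N_norm.
exists (norm2 u * K) => _ [v /= v1 <-].
rewrite (le_trans (Cauchy_Schwarz u v))// ler_wpM2l ?norm2_ge0//.
by rewrite (le_trans (NK v))// -[leRHS]mulr1 ler_pM2l.
Qed.

Lemma dual_norm_ge0 u : 0 <= dual_norm N u.
Proof.
apply: (ub_le_sup (dual_norm_ub u)); exists 0; last by rewrite dot0r.
by rewrite /= is_norm_0// ler01.
Qed.

Lemma dot_le_dual_norm u v : dot u v <= dual_norm N u * N v.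
Proof.
have [->|v0] := eqVneq v 0; first by rewrite dot0r is_norm_0// mulr0.
have Nv := is_norm_gt0 _ N_norm _ v0.
rewrite -ler_pdivrMr// mulrC -dotZr.
apply: (ub_le_sup (dual_norm_ub u)); exists ((N v)^-1 *: v) => //=.
by rewrite is_norm_scale// ger0_norm ?invr_ge0 ?(ltW Nv)// mulVf ?gt_eqF.
Qed.

Lemma dual_norm_le u a :
  0 <= a -> (forall v, dot u v <= a * N v) -> dual_norm N u <= a.
Proof.
move=> a0 ua; apply: ge_sup => [|_ [v /= v1 <-]].
  by exists 0; exists 0; rewrite /= ?dot0r// is_norm_0// ler01.
by rewrite (le_trans (ua v))// ler_piMr.
Qed.

(** The inequality <= for all scalars suffices: applied to a^-1 and a u, it gives the converse. *)
Lemma dual_normZ a u : dual_norm N (a *: u) = `|a| * dual_norm N u.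
Proof.
have le b v : dual_norm N (b *: v) <= `|b| * dual_norm N v.
  apply: dual_norm_le => [|w]; first by rewrite mulr_ge0 ?dual_norm_ge0.
  rewrite dotZl -dotZr (le_trans (dot_le_dual_norm _ _))//.
  by rewrite is_norm_scale// mulrCA mulrA.
apply/eqP; rewrite eq_le le/=.
have [->|a0] := eqVneq a 0; first by rewrite normr0 mul0r dual_norm_ge0.
rewrite mulrC -ler_pdivlMr ?normr_gt0// mulrC -normfV.
by rewrite -[in leLHS](scalerK a0 u) le.
Qed.

Lemma dual_normN u : dual_norm N (- u) = dual_norm N u.
Proof. by rewrite -scaleN1r dual_normZ normrN1 mul1r. Qed.

Lemma dual_norm0 : dual_norm N 0 = 0.
Proof. by rewrite -(scale0r 0) dual_normZ normr0 mul0r. Qed.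

Lemma dual_norm_eq0 u : dual_norm N u = 0 -> u = 0.
Proof.
move=> u0; apply: dot_eq0; apply/eqP; rewrite eq_le dot_ge0 andbT.
by rewrite (le_trans (dot_le_dual_norm _ _))// u0 mul0r.
Qed.

Lemma dual_norm_gt0 u : u != 0 -> 0 < dual_norm N u.
Proof.
move=> u0; rewrite lt0r dual_norm_ge0 andbT.
by apply: contra u0 => /eqP/dual_norm_eq0 ->.
Qed.

End DualNorm.

(** Stands in for a limit s -> 0 once an inequality has been divided by s. If a > b, an s with s
    (|q| + 1) <= a - b contradicts the assumption. *)
Lemma le_of_small (R : realType) (a b q m : R) : 0 < m ->
  (forall s, 0 < s -> s <= m -> a <= b + s * q) -> a <= b.
Proof.
move=> m0 H; rewrite leNgt; apply/negP => ab.
have q1 : 0 < `|q| + 1 by rewrite ltr_wpDl.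
pose s := Num.min m ((a - b) / (`|q| + 1)).
have s0 : 0 < s by rewrite lt_min m0 divr_gt0// subr_gt0.
have := H s s0; rewrite ge_min lexx => /(_ isT) h.
have : s * (`|q| + 1) <= a - b by rewrite -ler_pdivlMr// ge_min lexx orbT.
have : s * q <= s * `|q| by rewrite ler_pM2l// ler_norm.
by rewrite mulrDr mulr1; lra.
Qed.

(** * Contraction properties versus inner products *)

Section Implications.
Context {R : realType} {d : nat}.
Variables (C : set 'rV[R]_d) (N : 'rV[R]_d -> R) (N_norm : is_norm N).
Implicit Types (a : R) (x y z w p q u v : 'rV[R]_d).

Lemma inner_productsE (c : R) x y : inner_products C N c%:E x y <->
  forall z, is_proj C z x ->
    dot (y - x) (z - x) <= c * dual_norm N (z - x) * dot (y - x) (y - x).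
Proof.
by split=> H z /H; rewrite -!EFinM lee_fin sqr_norm2.
Qed.

Lemma is_proj_self y : C y -> is_proj C y y.
Proof.
by move=> Cy; split=> // u _; rewrite subrr /norm2 dot0r sqrtr0 sqrtr_ge0.
Qed.

Lemma two_sided_one_sided (g : \bar R) x y : C y ->
  two_sided_contraction C N g x y -> one_sided_contraction C N g x y.
Proof.
move=> Cy H z zx; have := H z y zx (is_proj_self y Cy).
by rewrite subrr dual_norm0// mule0 sube0.
Qed.

(** Rests on <x - y, z - w> = |x - y|^2 - <y - x, z - x> - <x - y, w - y>: the hypotheses bound the
    last two terms, Cauchy-Schwarz bounds the left side, and |x - y| cancels. *)
Lemma inner_products_two_sided (c : R) x y : inner_products C N c%:E x y ->
  inner_products C N c%:E y x -> two_sided_contraction C N c%:E x y.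
Proof.
move=> /inner_productsE Hxy /inner_productsE Hyx z w zx wy.
rewrite -!EFinM lee_fin.
have [->|D0] := eqVneq (norm2 (x - y)) 0; first by rewrite mulr0 norm2_ge0.
have Dp : 0 < norm2 (x - y) by rewrite lt0r D0 norm2_ge0.
have := Hxy z zx; have := Hyx w wy.
set a := dual_norm N _; set b := dual_norm N _ => h1 h2.
rewrite -(ler_pM2l Dp); apply: le_trans (Cauchy_Schwarz _ _).
rewrite mulrCA -expr2 sqr_norm2; move: h1 h2.
by rewrite !dotE !(dotC y) !(dotC z) !(dotC w); lra.
Qed.

Lemma is_proj_segment z x (s : R) : 0 <= s <= 1 -> is_proj C z x ->
  is_proj C (x + s *: (z - x)) x.
Proof.
move=> /andP[s0 s1] [Cx zx]; split=> // u Cu; have := zx u Cu; rewrite !norm2_le.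
have -> : x - (x + s *: (z - x)) = s *: (x - z).
  by rewrite opprD addrA subrr add0r -scalerN opprB.
have -> : x - z = (x - u) + (u - z) by rewrite addrA subrK.
have -> : u - (x + s *: (z - x)) = (s - 1) *: (x - u) + s *: (u - z).
  apply/rowP => i; rewrite !mxE; ring.
(* The claim amounts to (1 - s) |a|^2 - s (|a|^2 + 2 <a, b>) >= 0, and the optimality of x says
   |a|^2 + 2 <a, b> <= 0. *)
move: (x - u) (u - z) => a b.
have := dot_ge0 a.
rewrite !dotE !(dotC b a) => ha h.
have : s * (dot a a + dot a b *+ 2) <= 0.
  by rewrite mulr_ge0_le0// mulr2n; lra.
rewrite mulr2n.
have : s * dot a a <= dot a a by rewrite ler_piMl.
lra.
Qed.

(** The points x + s (z - x) still project to x. Squaring the contraction there, the terms |x - y|^2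
    cancel, and the terms linear in s give the claim as s -> 0. *)
Lemma one_sided_inner_products (c : R) x y : 0 <= c ->
  one_sided_contraction C N c%:E x y -> inner_products C N c%:E x y.
Proof.
move=> c0 H; apply/inner_productsE => z zx.
set a := dual_norm N (z - x); have a0 : 0 <= a by exact: dual_norm_ge0.
have ca1 : 0 < 1 + c * a by rewrite ltr_pwDl// mulr_ge0.
(* The bound on s ensures s <= 1 and c s a <= 1, so that the contraction factor is nonnegative and
   may be squared. *)
apply: (@le_of_small _ _ _ (dot (z - x) (z - x)) (1 + c * a)^-1).
  by rewrite invr_gt0.
move=> s s0; rewrite -[_^-1]mul1r ler_pdivlMr// mulrDr mulr1 => sca.
have ca0 : 0 <= c * a by rewrite mulr_ge0.
have sca0 : 0 <= s * (c * a) by rewrite mulr_ge0// ltW.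
have s01 : 0 <= s <= 1 by apply/andP; split; lra.
have := H _ (is_proj_segment _ _ _ s01 zx).
rewrite -!EFinM lee_fin.
have -> : x + s *: (z - x) - x = s *: (z - x) by rewrite addrC addKr.
rewrite dual_normZ// gtr0_norm// -/a => h.
have : ((1 - c * (s * a)) * norm2 (x - y)) ^+ 2
    <= norm2 (x + s *: (z - x) - y) ^+ 2.
  by rewrite ler_pXn2r// nnegrE ?norm2_ge0// mulr_ge0 ?norm2_ge0//; lra.
have -> : x + s *: (z - x) - y = s *: (z - x) - (y - x).
  by apply/rowP => i; rewrite !mxE; ring.
have -> : x - y = - (y - x) by rewrite opprB.
rewrite norm2N exprMn !sqr_norm2.
move: (y - x) (z - x) (dot_ge0 (y - x)) (dot_ge0 (z - x)) => e f D0 F0.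
rewrite !dotE (dotC f e) => {}h; rewrite -(ler_pM2l s0).
have : 0 <= (c * (s * a)) ^+ 2 * dot e e by rewrite mulr_ge0// sqr_ge0.
have : 0 <= s ^+ 2 * dot f f by rewrite mulr_ge0// sqr_ge0.
lra.
Qed.

End Implications.

(** * Gradients, and the test function for projections *)

Section Gradient.
Context {R : realType} {d : nat}.
Implicit Types (x y z u v : 'rV[R]_d).

(** A smooth function whose minimizers over [C] are the projections of z; the factor 1/2 makes its
    gradient exactly p - z. *)
Definition half_sqr_dist z : 'rV[R]_d -> R := fun p => dot (p - z) (p - z) / 2.

Lemma differentiable_half_sqr_dist z p : differentiable (half_sqr_dist z) p.
Proof.
have coord (i : 'I_d) : differentiable (fun q : 'rV[R]_d => q 0 i - z 0 i) p.
  by apply: differentiableB => //; exact: differentiable_coord.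
have -> : half_sqr_dist z = (\sum_(i < d) fun q : 'rV[R]_d =>
    (q 0 i - z 0 i) * (q 0 i - z 0 i)) * cst 2^-1.
  apply/funext => q; rewrite /half_sqr_dist /dot fctE fct_sumE; congr (_ * _).
  by apply: eq_bigr => i _; rewrite !mxE.
apply: differentiableM => //; apply: differentiable_sum => i.
exact: differentiableM.
Qed.

Lemma half_sqr_distD z p v : half_sqr_dist z (p + v) =
  half_sqr_dist z p + dot (p - z) v + dot v v / 2.
Proof.
rewrite /half_sqr_dist (_ : p + v - z = (p - z) + v); last by rewrite addrAC.
by rewrite !dotE (dotC v p) (dotC v z); lra.
Qed.

Lemma grad_half_sqr_dist z p : grad (half_sqr_dist z) p = p - z.
Proof.
apply/rowP => j; rewrite [LHS]mxE.
set e := delta_mx 0 j.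
have -> : (p - z) 0 j = dot (p - z) e.
  rewrite /dot (bigD1 j)//= [e 0 j]mxE !eqxx mulr1 big1 ?addr0// => i ij.
  by rewrite [e 0 i]mxE eqxx (negbTE ij) mulr0.
rewrite /derive; apply/cvg_lim => //.
(* The function is quadratic, so its difference quotient is affine in h. *)
apply: (@cvg_trans _ ((fun h : R => dot (p - z) e + h * (dot e e / 2)) @ 0^')).
  apply: near_eq_cvg; near=> h.
  have h0 : h != 0 by near: h; exact: nbhs_dnbhs_neq.
  rewrite /= [h *: e + p]addrC half_sqr_distD. rewrite !dotE.
  by rewrite /GRing.scale/=; field.
have : dot (p - z) e + h * (dot e e / 2) @[h --> 0^'] -->
    dot (p - z) e + 0 * (dot e e / 2).
  apply: cvgD; first exact: cvg_cst.
  by apply: cvgMl; exact: nbhs_dnbhs.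
by rewrite mul0r addr0.
Unshelve. all: by end_near. Qed.

Lemma diff_grad (f : 'rV[R]_d -> R) x v : differentiable f x ->
  'd f x v = dot (grad f x) v.
Proof.
move=> fx; rewrite {1}(row_sum_delta v) linear_sum; apply: eq_bigr => i _.
by rewrite linearZ mxE deriveE// mulrC.
Qed.

Lemma first_order_approx (f : 'rV[R]_d -> R) x (e : R) : differentiable f x ->
  0 < e -> \forall h \near (0 : 'rV[R]_d), f (h + x) <= f x + dot (grad f x) h + e * `|h|.
Proof.
move=> fx e0.
have /eqaddoP/(_ e e0) := diff_locally fx.
apply: filterS => h /=; rewrite -diff_grad// !fctE/= => H.
by have := le_trans (ler_norm _) H; lra.
Qed.

End Gradient.

(** Apply first-order optimality to [half_sqr_dist z], minimized over [C] at x with gradient x -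
    z. *)
Lemma first_order_inner_products {R : realType} {d : nat} (C : set 'rV[R]_d)
    (N : 'rV[R]_d -> R) (g : \bar R) x y : is_norm N ->
  first_order_optimality C N g x y -> inner_products C N g x y.
Proof.
move=> N_norm H z [Cx zx].
have := H (half_sqr_dist z) (differentiable_half_sqr_dist z).
rewrite grad_half_sqr_dist -(opprB z x) dual_normN// dotNr EFinN leeN2; apply.
split=> //; apply: (@nearW _ (nbhs x)) => u Cu; have := zx u Cu.
by rewrite norm2_le /half_sqr_dist ler_pM2r ?invr_gt0.
Qed.

(** Turns the extended-real limsup, an infimum of suprema over neighborhoods, into an epsilon
    condition on reals. *)
Lemma limf_esup_right_le {R : realType} (f : R -> R) (b : R) :
  (limf_esup (fun t => (f t)%:E) 0^'+ <= b%:E)%E <->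
  forall e, 0 < e -> \forall t \near 0^'+, f t <= b + e.
Proof.
split=> [fb e e0|H].
  have : (limf_esup (fun t => (f t)%:E) 0^'+ < (b + e)%:E)%E.
    by rewrite (le_lt_trans fb)// lte_fin ltrDl.
  move=> /ereal_inf_lt[_ [A FA <-]] Ab.
  apply: filterS FA => t At; rewrite -lee_fin (le_trans _ (ltW Ab))//.
  by apply: ereal_sup_ubound; exists t.
apply/lee_addgt0Pr => e e0; rewrite -EFinD.
apply: (@le_trans _ _ (ereal_sup ((fun t => (f t)%:E) @` [set t | f t <= b + e]))).
  by apply: ereal_inf_lbound; exists [set t | f t <= b + e] => //; exact: H.
by apply: ge_ereal_sup => _ [t /= ft <-]; rewrite lee_fin.
Qed.

(** * Distance to the set, and from curvature to first-order optimality *)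

Section Dist.
Context {R : realType} {d : nat}.
Variables (C : set 'rV[R]_d) (N : 'rV[R]_d -> R) (N_norm : is_norm N).

Lemma dist_has_lbound p : has_lbound [set N (z - p) | z in C].
Proof. by exists 0 => _ [z _ <-]; exact: is_norm_ge0. Qed.

Lemma dist_le z p : C z -> dist N C p <= N (z - p).
Proof. by move=> Cz; apply: (ge_inf (dist_has_lbound p)); exists z. Qed.

Lemma dist_adherent p (e : R) : C !=set0 -> 0 < e ->
  exists2 z, C z & N (z - p) < dist N C p + e.
Proof.
move=> [x Cx] e0; have [|_ [z Cz <-] ze] := @inf_adherent _ [set N (z - p) | z in C] _ e0.
  by split; [exists (N (x - p)); exists x|exact: dist_has_lbound].
by exists z.
Qed.

End Dist.

(** Curvature puts a point z of [C] near x + t (y - x), with error about b t in [N]. Local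
    minimality and the expansion of f at x bound <G, z - x> below up to o(t); the error costs at
    most its size times the dual norm of G. Then divide by t. *)
Lemma curvature_first_order {R : realType} {d : nat} (C : set 'rV[R]_d)
    (N : 'rV[R]_d -> R) (c : R) x y : is_norm N -> 0 <= c ->
  curvature C N c%:E x y -> first_order_optimality C N c%:E x y.
Proof.
move=> N_norm c0; rewrite /curvature -EFinM => /limf_esup_right_le H f fd [Cx fx].
rewrite -!EFinM -EFinN lee_fin.
have -> : norm2 (y - x) = norm2 (x - y) by rewrite -norm2N opprB.
set b := c * _ ^+ 2 in H.
have b0 : 0 <= b by rewrite mulr_ge0// sqr_ge0.
set G := grad f x; set a := dual_norm N G.
have a0 : 0 <= a by exact: dual_norm_ge0.
have [K K0 NK] := sup_le_is_norm _ N_norm.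
(* Bounds |z - x| / t: the segment contributes |y - x|, the [N]-error at most b + 2 s with s <=
   1. *)
pose L := `|y - x| + K * (b + 2).
have L0 : 0 < L by rewrite ltr_wpDl// mulr_gt0// ltr_wpDl.
suff : 0 <= dot (y - x) G + a * b by rewrite /b; lra.
(* The errors of order s: 2 a from the distance to the segment, L from the remainder of f. *)
apply: (@le_of_small _ _ _ (2 * a + L) 1) => // s s0 s1.
have /nbhs_norm0P[r /= r0 Hr] : \forall h \near (0 : 'rV[R]_d),
    C (h + x) -> 0 <= dot G h + s * `|h|.
  have : \forall h \near (0 : 'rV[R]_d), C (h + x) -> f x <= f (h + x).
    by move: fx; rewrite (near_shift 0) subr0.
  apply: filterS2 (first_order_approx _ _ _ (fd x) s0) => h h1 h2 /h2 h3.
  by rewrite -/G in h1; lra.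
near (0 : R)^'+ => t.
have t0 : 0 < t by near: t; exact: nbhs_right_gt.
have tL : t * L < r.
  rewrite -ltr_pdivlMr//; near: t; apply: nbhs_right_lt; exact: divr_gt0.
have Ht : dist N C ((1 - t) *: x + t *: y) / t <= b + s.
  by near: t; exact: H.
have ts0 : 0 < t * s by exact: mulr_gt0.
have C0 : C !=set0 by exists x.
(* An almost nearest point, with slack t s. *)
have [z Cz] := dist_adherent _ _ N_norm ((1 - t) *: x + t *: y) _ C0 ts0.
set xt := (1 - t) *: x + t *: y => hz.
have {}hz : N (z - xt) <= t * (b + 2 * s).
  by move: Ht; rewrite ler_pdivrMr// -/xt; lra.
have zx : z - x = t *: (y - x) + (z - xt).
  by rewrite /xt; apply/rowP => i; rewrite !mxE; ring.
have zL : `|z - x| <= t * L.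
  rewrite zx (le_trans (ler_normD _ _))// normrZ gtr0_norm// mulrDr lerD2l.
  rewrite (le_trans (NK _))// mulrCA ler_pM2l// (le_trans hz)// ler_pM2l//.
  lra.
have /Hr : `|z - x| < r by exact: le_lt_trans zL tL.
rewrite subrK => /(_ Cz); rewrite {1}zx dotDr dotZr (dotC G (y - x)) => h.
have h1 : dot G (z - xt) <= a * (t * (b + 2 * s)).
  by rewrite (le_trans (dot_le_dual_norm _ N_norm _ _))// ler_wpM2l.
have h2 : s * `|z - x| <= s * (t * L) by rewrite ler_pM2l.
rewrite -(ler_pM2l t0); lra.
Unshelve. all: by end_near. Qed.

(** * The penalized minimization, and from inner products to curvature *)

Section Penalized.
Context {R : realType} {d : nat}.
Variables (C : set 'rV[R]_d) (N : 'rV[R]_d -> R) (N_norm : is_norm N).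
Hypothesis C_closed : closed C.
Implicit Types (a e : R) (x y z w p q u v : 'rV[R]_d).

(** Splitting z from p lets the penalty alone govern z, making it a Euclidean projection, while [N]
    acts only on the unconstrained p. *)
Definition penalized e q (zp : 'rV[R]_d * 'rV[R]_d) : R :=
  N (zp.2 - q) + dot (zp.1 - zp.2) (zp.1 - zp.2) / (2 * e).

Lemma penalized_continuous e q : continuous (penalized e q).
Proof.
move=> zp; apply: cvgD; last (apply: cvgM; last exact: cvg_cst).
  apply: (@continuous_comp _ _ _ (fun zp : 'rV[R]_d * 'rV[R]_d => zp.2 - q) N).
    by apply: cvgB; [exact: cvg_snd|exact: cvg_cst].
  exact: is_norm_continuous.
have -> : (fun zp : 'rV[R]_d * 'rV[R]_d => dot (zp.1 - zp.2) (zp.1 - zp.2)) =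
    fun zp => norm2 (zp.1 - zp.2) * norm2 (zp.1 - zp.2).
  by apply/funext => w; rewrite -sqr_norm2.
rewrite -sqr_norm2 expr2.
have : norm2 (zp0.1 - zp0.2) @[zp0 --> zp] --> norm2 (zp.1 - zp.2).
  apply: (@continuous_comp _ _ _ (fun zp : 'rV[R]_d * 'rV[R]_d => zp.1 - zp.2)
    (@norm2 R d)).
    by apply: cvgB; [exact: cvg_fst|exact: cvg_snd].
  exact: is_norm_continuous _ is_norm_norm2 _.
by move=> h; exact: cvgM.
Qed.

Lemma closed_ball_compact q (r : R) (A : set 'rV[R]_d) : closed A ->
  compact (A `&` [set z | `|z - q| <= r]).
Proof.
move=> Acl; apply: bounded_closed_compact.
  exists (r + `|q|); split; first exact: num_real.
  move=> s rs z [_ /= zq]; rewrite -(subrK q z) (le_trans (ler_normD _ _))//.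
  lra.
apply: closedI => //.
apply: (@closed_comp _ _ (fun z : 'rV[R]_d => `|z - q|) [set s | s <= r]).
  move=> z _; apply: (@continuous_comp _ _ _ (fun z : 'rV[R]_d => z - q)).
    apply: (@cvgB _ _ _ (nbhs z) (nbhs_filter z) id (cst q)); last exact: cvg_cst.
    exact: cvg_id.
  exact: norm_continuous.
exact: closed_le.
Qed.

(** The sublevel set of the value M at (x, x) lies in a compact box, on which the continuous
    objective attains its minimum. *)
Lemma penalized_min e q : 0 < e -> C !=set0 -> exists z p, C z /\
  forall z' p', C z' -> penalized e q (z, p) <= penalized e q (z', p').
Proof.
move=> e0 [x Cx]; pose M := N (x - q).
have M0 : 0 <= M by exact: is_norm_ge0.
have penx : penalized e q (x, x) = M by rewrite /penalized/= subrr dot0r mul0r addr0.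
have [K K0 NK] := sup_le_is_norm _ N_norm.
have [K2 K20 NK2] := sup_le_is_norm _ (@is_norm_norm2 R d).
(* [r1] bounds p - q through [N]; [r2] adds a bound on z - p, using n <= n^2 + 1 to avoid a square
   root. *)
pose r1 := K * M; pose r2 := r1 + K2 * (M * (2 * e) + 1).
have r12 : r1 <= r2 by rewrite lerDl mulr_ge0 ?ltW// ltr_wpDl// mulr_ge0// mulr_ge0// ltW.
pose A := (C `&` [set z | `|z - q| <= r2]) `*` (setT `&` [set z | `|z - q| <= r1]).
have cA : compact A.
  by apply: compact_setX; apply: closed_ball_compact => //; exact: closedT.
have inA z p : C z -> penalized e q (z, p) <= M -> A (z, p).
  move=> Cz; rewrite /penalized/= => h.
  have h1 : 0 <= N (p - q) by exact: is_norm_ge0.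
  have h2 : 0 <= dot (z - p) (z - p) / (2 * e).
    by rewrite divr_ge0 ?dot_ge0// mulr_ge0// ltW.
  have hp : `|p - q| <= r1 by rewrite (le_trans (NK _))// ler_pM2l//; lra.
  split; split => //=.
  have -> : z - q = (p - q) + (z - p) by rewrite [RHS]addrC addrA subrK.
  rewrite (le_trans (ler_normD _ _))// lerD//.
  rewrite (le_trans (NK2 _))// ler_pM2l//.
  have : dot (z - p) (z - p) <= M * (2 * e).
    by rewrite -ler_pdivrMr ?mulr_gt0//; lra.
  by rewrite -sqr_norm2; have := sqr_ge0 (norm2 (z - p) - 1); nra.
have Ax : A (x, x) by apply: inA => //; rewrite penx.
have A0 : A !=set0 by exists (x, x).
have cpen : {within A, continuous (penalized e q)}.
  by apply: continuous_subspaceT; exact: penalized_continuous.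
have [[z p] /set_mem[[/= Cz zq] pq] zpmin] := compact_EVT_min A0 cA cpen.
exists z, p; split=> // z' p' Cz'.
(* Outside the sublevel set the value exceeds M, which is at least the minimum over the box. *)
have [le_M|/ltW] := leP (penalized e q (z', p')) M.
  by apply: zpmin; rewrite inE; exact: inA.
by apply: le_trans; rewrite -penx; apply: zpmin; rewrite inE.
Qed.

Section Minimizer.
Variables (e : R) (e0 : 0 < e) (q z p : 'rV[R]_d) (Cz : C z).
Hypothesis zpmin :
  forall z' p', C z' -> penalized e q (z, p) <= penalized e q (z', p').
Let u := e^-1 *: (z - p).

Lemma penalized_min_is_proj : is_proj C p z.
Proof.
split=> // w Cw; have := zpmin _ p Cw.
by rewrite norm2_le lerD2l ler_pM2r// invr_gt0 mulr_gt0.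
Qed.

(** Optimality in p alone: moving p by s v changes the penalty by - s <u, v> plus a term of order
    s^2. *)
Lemma penalized_min_step v (s : R) :
  N (p - q) + s * dot u v <= N (p - q + s *: v) + s ^+ 2 * (dot v v / (2 * e)).
Proof.
have := zpmin _ (p + s *: v) Cz; rewrite /penalized/=.
have -> : p + s *: v - q = p - q + s *: v by rewrite addrAC.
have -> : z - (p + s *: v) = e *: u - s *: v.
  by rewrite /u scalerKV ?gt_eqF// opprD addrA.
have -> : z - p = e *: u by rewrite /u scalerKV ?gt_eqF.
clearbody u.
have -> : dot (e *: u - s *: v) (e *: u - s *: v) / (2 * e) =
    dot (e *: u) (e *: u) / (2 * e) - s * dot u v + s ^+ 2 * (dot v v / (2 * e)).
  by rewrite !dotE (dotC v u); field; rewrite gt_eqF.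
lra.
Qed.

Lemma penalized_min_dual v : dot u v <= N v.
Proof.
apply: (@le_of_small _ _ _ (dot v v / (2 * e)) 1) => // s s0 _.
have := penalized_min_step v s.
have := is_norm_triangle N_norm (p - q) (s *: v).
rewrite is_norm_scale// gtr0_norm// => h1 h2.
by rewrite -(ler_pM2l s0); lra.
Qed.

(** Step from p towards q: this direction scales [N (p - q)] by exactly 1 - s. *)
Lemma penalized_min_aligned : N (p - q) <= dot u (p - q).
Proof.
set v := p - q.
apply: (@le_of_small _ _ _ (dot v v / (2 * e)) 1) => // s s0 s1.
have := penalized_min_step (- v) s; rewrite -/v.
have -> : v + s *: - v = (1 - s) *: v by rewrite scalerBl scale1r scalerN.
rewrite is_norm_scale// ger0_norm ?subr_ge0// !dotE => h.
by rewrite -(ler_pM2l s0); lra.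
Qed.

End Minimizer.

Lemma inner_products_dist (c : R) x y : 0 <= c -> C x -> C y ->
  (forall x' y', C x' -> C y' -> inner_products C N c%:E x' y') ->
  exists M, forall t, 0 < t -> t <= 1 ->
    dist N C ((1 - t) *: x + t *: y) <= t * (c * dot (x - y) (x - y) + t * M).
Proof.
move=> c0 Cx Cy H.
have [K K0 NK] := is_norm_equiv _ _ N_norm (@is_norm_norm2 R d).
have [K2 K20 NK2] := is_norm_equiv _ _ (@is_norm_norm2 R d) N_norm.
(* Bounds |z - q|_2 / t: the first term comes from p - q, the second from e u, as |u|_2 <= K and e
   <= t. *)
pose L := K2 * N (y - x) + K.
have L0 : 0 <= L by rewrite addr_ge0 ?mulr_ge0 ?is_norm_ge0 ?ltW.
(* c L^2 absorbs c |z - q|_2^2, and K^2 absorbs e N(u) with e = t^2. *)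
exists (c * L ^+ 2 + K ^+ 2) => t t0 t1.
set q := _ + _; set e := t ^+ 2; have e0 : 0 < e by rewrite exprn_gt0.
have C0 : C !=set0 by exists x.
have [z [p [Cz zpmin]]] := penalized_min _ q e0 C0.
have proj := penalized_min_is_proj _ e0 _ _ _ Cz zpmin.
have dual := penalized_min_dual _ e0 _ _ _ Cz zpmin.
have align := penalized_min_aligned _ e0 _ _ _ Cz zpmin.
set u := e^-1 *: (z - p) in dual align.
have zp : z - p = e *: u by rewrite /u scalerKV ?gt_eqF.
have u1 : dual_norm N u <= 1.
  by apply: dual_norm_le => // v; rewrite mul1r.
(* The inner product property at (z, w) for p, with p - z = - e u: dividing by e leaves the dual
   norm of u, at most 1. *)
have slope w : C w -> dot (w - z) (- u) <= c * dot (w - z) (w - z).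
  move=> Cw; have /inner_productsE/(_ _ proj) := H _ _ Cz Cw.
  rewrite -(opprB z p) zp dual_normN// dual_normZ// gtr0_norm//.
  rewrite !dotNr dotZr -mulrN => h; rewrite -(ler_pM2l e0) (le_trans h)//.
  rewrite [leRHS]mulrCA mulrA -[leRHS]mulr1.
  have := dual_norm_ge0 _ N_norm u.
  have cD : 0 <= c * e * dot (w - z) (w - z).
    by rewrite mulr_ge0 ?dot_ge0// mulr_ge0// ltW.
  by have := ler_wpM2l cD u1; lra.
(* Testing u against itself: |u|_2^2 <= N(u) <= K |u|_2. *)
have norm2u : norm2 u <= K.
  have [->|u0] := eqVneq (norm2 u) 0; first exact: ltW.
  have up : 0 < norm2 u by rewrite lt0r u0 norm2_ge0.
  by rewrite -(ler_pM2r up) -expr2 sqr_norm2 (le_trans (dual u)).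
have Nu : N u <= K ^+ 2.
  by rewrite (le_trans (NK u))// expr2 ler_pM2l.
(* Comparison with the competitor (x, x). *)
have Npq : N (p - q) <= t * N (y - x).
  have := zpmin x x Cx; rewrite /penalized/= subrr dot0r mul0r addr0.
  have -> : x - q = - (t *: (y - x)).
    by apply/rowP => i; rewrite /q !mxE; ring.
  rewrite is_norm_N// is_norm_scale// gtr0_norm//; apply: le_trans.
  by rewrite lerDl divr_ge0 ?dot_ge0// mulr_ge0// ltW.
have zq : z - q = (p - q) + e *: u by rewrite -zp [RHS]addrC addrA subrK.
have norm2zq : norm2 (z - q) <= t * L.
  rewrite zq (le_trans (is_norm_triangle is_norm_norm2 _ _))// /L mulrDr lerD//.
    by rewrite (le_trans (NK2 _))// mulrCA ler_pM2l.
  rewrite norm2Z gtr0_norm//; apply: ler_pM => //; [exact: ltW|exact: norm2_ge0|].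
  by rewrite /e expr2 ler_piMr// ltW.
have dotzq : dot (z - q) (z - q) <= t ^+ 2 * L ^+ 2.
  by rewrite -sqr_norm2 -exprMn ler_pXn2r// nnegrE ?norm2_ge0// mulr_ge0// ltW.
apply: le_trans (_ : N (z - q) <= _); first exact: dist_le.
have Nzq : N (z - q) <= N (p - q) + e * N u.
  by rewrite zq (le_trans (is_norm_triangle N_norm _ _))// is_norm_scale// gtr0_norm.
(* The variance identity for the weighted mean q of x and y. *)
have convex : (1 - t) * dot (x - z) (x - z) + t * dot (y - z) (y - z) =
    dot (z - q) (z - q) + t * (1 - t) * dot (x - y) (x - y).
  by rewrite /q !dotE !(dotC y) !(dotC z); ring.
have combine : dot (z - q) u = (1 - t) * dot (x - z) (- u) + t * dot (y - z) (- u).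
  by rewrite /q !dotE; ring.
have dotu : N (p - q) <= dot (z - q) u.
  rewrite zq dotDl dotZl (dotC (p - q)) (le_trans align)// lerDl mulr_ge0 ?dot_ge0//.
  exact: ltW.
have sx := slope x Cx; have sy := slope y Cy.
have t1' : 0 <= 1 - t by rewrite subr_ge0.
have {}sx := ler_wpM2l t1' sx; have {}sy := ler_wpM2l (ltW t0) sy.
have bound : N (p - q) <= c * (t ^+ 2 * L ^+ 2 + t * dot (x - y) (x - y)).
  apply: le_trans dotu _; rewrite combine.
  apply: le_trans (lerD sx sy) _.
  rewrite mulrCA [X in _ + X]mulrCA -mulrDr convex ler_wpM2l// lerD//.
  by rewrite ler_wpM2r ?dot_ge0// ler_piMr ?(ltW t0)// gerBl (ltW t0).
have eNu : e * N u <= e * K ^+ 2 by rewrite ler_pM2l.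
by move: Nzq bound eNu; rewrite /e; lra.
Qed.

Lemma inner_products_curvature (c : R) : 0 <= c ->
  (forall x y, C x -> C y -> inner_products C N c%:E x y) ->
  forall x y, C x -> C y -> curvature C N c%:E x y.
Proof.
move=> c0 H x y Cx Cy; rewrite /curvature -EFinM; apply/limf_esup_right_le => s s0.
have [M HM] := inner_products_dist _ _ _ c0 Cx Cy H.
have M1 : 0 < `|M| + 1 by rewrite ltr_wpDl.
near=> t.
have t0 : 0 < t by near: t; exact: nbhs_right_gt.
have t1 : t <= 1 by near: t; exact: nbhs_right_le.
have tM : t * (`|M| + 1) < s.
  by rewrite -ltr_pdivlMr//; near: t; apply: nbhs_right_lt; exact: divr_gt0.
rewrite ler_pdivrMr// mulrC (le_trans (HM t t0 t1))// ler_pM2l// sqr_norm2 lerD2l.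
rewrite (le_trans _ (ltW tM))// ler_pM2l// (le_trans (ler_norm M))// lerDl//.
Unshelve. all: by end_near. Qed.

End Penalized.

(** * The case of infinite gamma, where only products 0 * +oo need separate care *)

Section Infinity.
Context {R : realType} {d : nat}.
Variables (C : set 'rV[R]_d) (N : 'rV[R]_d -> R) (N_norm : is_norm N).
Implicit Types x y u : 'rV[R]_d.

Lemma curvature_infty x y : C x -> curvature C N +oo%E x y.
Proof.
move=> Cx; rewrite /curvature.
have [->|xy] := eqVneq y x; last first.
  by rewrite gt0_mulye ?leey// lte_fin exprn_gt0// norm2_gt0// subr_eq0 eq_sym.
rewrite subrr (is_norm_0 _ is_norm_norm2) expr0n/= mule0.
apply/limf_esup_right_le => e e0; apply: nearW => t.
rewrite -scalerDl subrK scale1r add0r.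
suff -> : dist N C x = 0 by rewrite mul0r ltW.
apply/eqP; rewrite eq_le; apply/andP; split.
  by rewrite (le_trans (dist_le _ _ N_norm _ _ Cx))// subrr is_norm_0.
by apply: lb_le_inf => [|_ [z _ <-]]; [exists (N (x - x)); exists x|exact: is_norm_ge0].
Qed.

Lemma first_order_infty x y : first_order_optimality C N +oo%E x y.
Proof.
move=> f _ _; set G := grad f x.
have [->|G0] := eqVneq G 0.
  by rewrite dot0r dual_norm0// mule0 mul0e oppe0.
have [->|xy] := eqVneq y x.
  by rewrite subrr dotC dot0r (is_norm_0 _ is_norm_norm2) expr0n/= mule0 oppe0.
rewrite [X in (X * _)%E]gt0_mulye ?lte_fin ?dual_norm_gt0//.
by rewrite gt0_mulye ?leNye// lte_fin exprn_gt0// norm2_gt0// subr_eq0.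
Qed.

Lemma two_sided_infty x y : two_sided_contraction C N +oo%E x y.
Proof.
move=> z w _ _.
have [->|xy] := eqVneq x y.
  by rewrite subrr (is_norm_0 _ is_norm_norm2) mule0 lee_fin norm2_ge0.
have D0 : (0 < (norm2 (x - y))%:E)%E by rewrite lte_fin norm2_gt0// subr_eq0.
have d0 := dual_norm0 _ N_norm.
(* A nonzero displacement makes the contraction factor -oo; if both vanish, the factor is 1 and
   equality holds. *)
have [->|zx] := eqVneq z x; have [->|wy] := eqVneq w y.
- by rewrite !subrr d0 mule0 !sube0 mul1e.
- rewrite subrr d0 mule0 sube0 gt0_mulye ?lte_fin ?dual_norm_gt0 ?subr_eq0//.
  by rewrite addeNy gt0_mulNye// leNye.
- rewrite subrr d0 mule0 sube0 gt0_mulye ?lte_fin ?dual_norm_gt0 ?subr_eq0//.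
  by rewrite addeNy gt0_mulNye// leNye.
rewrite gt0_mulye ?lte_fin ?dual_norm_gt0 ?subr_eq0//.
by rewrite addeNy addNye gt0_mulNye// leNye.
Qed.

End Infinity.

(** * Assembly of the implications into the dichotomy *)

Theorem theorem1 (R : realType) (d : nat) (C : set 'rV[R]_d)
    (N : 'rV[R]_d -> R) (g : \bar R)
    (C_closed : closed C) (C_nonempty : C !=set0)
    (N_norm : is_norm N) (g_ge0 : (0 <= g)%E) :
  (forall x y : 'rV[R]_d, C x -> C y ->
     [/\ curvature C N g x y,
         two_sided_contraction C N g x y,
         one_sided_contraction C N g x y,
         first_order_optimality C N g x y
       & inner_products C N g x y])
  \/
  [/\ (exists x y : 'rV[R]_d, [/\ C x, C y & ~ curvature C N g x y]),
      (exists x y : 'rV[R]_d, [/\ C x, C y & ~ two_sided_contraction C N g x y]),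
      (exists x y : 'rV[R]_d, [/\ C x, C y & ~ one_sided_contraction C N g x y]),
      (exists x y : 'rV[R]_d, [/\ C x, C y & ~ first_order_optimality C N g x y])
    & (exists x y : 'rV[R]_d, [/\ C x, C y & ~ inner_products C N g x y])].
Proof.
(* -oo is excluded by [g_ge0]; for +oo all five properties hold at every pair. *)
case: g g_ge0 => [c||//]; last first.
  move=> _; left => x y Cx Cy; have fo := first_order_infty C N N_norm x y.
  have two := two_sided_infty C N N_norm x y.
  split=> //; first exact: curvature_infty.
    exact: two_sided_one_sided two.
  exact: first_order_inner_products fo.
move=> cE; have c0 : 0 <= c by rewrite -lee_fin.
(* The inner product property decides: if it holds at all pairs, it yields the other four. *)
have [H|H] := pselect (forall x y, C x -> C y -> inner_products C N c%:E x y).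
  left => x y Cx Cy.
  have curv : curvature C N c%:E x y by exact: inner_products_curvature.
  have two : two_sided_contraction C N c%:E x y.
    by apply: inner_products_two_sided; apply: H.
  split=> //; last exact: H.
    exact: two_sided_one_sided two.
  exact: curvature_first_order.
(* A property implying inner products pair by pair cannot hold at all pairs when inner products fail
   somewhere. *)
have fails (P : 'rV[R]_d -> 'rV[R]_d -> Prop) :
    (forall x y, C x -> C y -> P x y -> inner_products C N c%:E x y) ->
    exists x y, [/\ C x, C y & ~ P x y].
  move=> PI; apply: contrapT => nP; apply: H => x y Cx Cy; apply: PI => //.
  by apply: contrapT => nPxy; apply: nP; exists x, y.
right; split; apply: fails => x y Cx Cy // P.
- by apply: first_order_inner_products => //; exact: curvature_first_order.
- by apply: one_sided_inner_products => //; exact: two_sided_one_sided P.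
- exact: one_sided_inner_products.
- exact: first_order_inner_products P.
Qed.
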